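(* Let $S\subset\mathbb{P}^3$ be a smooth cubic surface over a field $K$. Suppose $S$ contains a $K$-rational line $\ell$. Then $H^0_S(K) = H_S(K)[2]$, where $H_S(K)[2]$ is the $2$-torsion subgroup of $H_S(K)$.
   Context: A $K$-line is a line $\ell \subset \mathbb{P}^3$ defined over $K$. If $\ell \not\subset S$ is a $K$-line, then $\ell\cdot S = P+Q+R$ denotes the intersection of $\ell$ with $S$ counted with multiplicity. Let $G_S(K)=\bigoplus_{P\in S(K)}\mathbb{Z}\cdot P$ be the free abelian group on $S(K)$. Let $G'_S(K)$ be the subgroup generated by all sums $P+Q+R$ with $P,Q,R\in S(K)$ (not necessarily distinct) such that (i) there is a $K$-line $\ell$ not contained in $S$ with $\ell\cdot S=P+Q+R$, or (ii) there is a $K$-line $\ell$ contained in $S$ with $P,Q,R\in\ell$. Let $\deg:G_S(K)\to\mathbb{Z}$, $\deg(\sum a_iP_i)=\sum a_i$, let $G''_S(K)=\{D\in G'_S(K):\deg(D)=0\}$, and $H_S(K)=G_S(K)/G''_S(K)$. The degree map descends to $\deg:H_S(K)\to\mathbb{Z}$, and $H^0_S(K)=\{D\in H_S(K):\deg(D)=0\}$. *)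

(* Defs.v *)
From HB Require Import structures.
From mathcomp Require Import all_boot all_order all_algebra.
From mathcomp Require Import ring_quotient generic_quotient.
From mathcomp Require Import freeg mpoly.
From mathcomp Require Import boolp.

Set Implicit Arguments.
Unset Strict Implicit.
Unset Printing Implicit Defensive.

Import GRing.Theory.

Local Open Scope ring_scope.
Local Open Scope quotient_scope.

(* P^3(K) is the set of one-dimensional subspaces of K^4, and a K-line is a
   two-dimensional subspace of K^4.  The surface S is the zero locus of a
   cubic form F in {mpoly K[4]}. *)

(* Smoothness is geometric: no common zero of F and its partial derivatives
   over any extension field of K, rational points alone being insufficient. *)
Definition smooth_surface (K : fieldType) (F : {mpoly K[4]}) : Prop :=
  forall (E : fieldType) (f : {rmorphism K -> E}) (v : 'rV[E]_4),
    v != 0 -> (map_mpoly f F).@[v 0] = 0 ->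
    exists i : 'I_4, (map_mpoly f F^`M(i)).@[v 0] != 0.

Section Surface.
Variables (K : fieldType) (F : {mpoly K[4]}).

(* As F is homogeneous, its vanishing on U can be tested on any nonzero vector
   of U. *)
Definition on_surface (U : {vspace 'rV[K]_4}) : bool :=
  (\dim U == 1)%N && (F.@[vpick U 0] == 0).

Definition surface_pt := {U : {vspace 'rV[K]_4} | on_surface U}.

Definition is_line (L : {vspace 'rV[K]_4}) : bool := (\dim L == 2)%N.

(* The polynomial F (v + t w) in the indeterminate t. *)
Definition line_poly (v w : 'rV[K]_4) : {poly K} :=
  mmap polyC (fun i => (v 0 i)%:P + (w 0 i)%:P * 'X) F.

(* The line is contained in the surface as a variety: F vanishes identically
   on it.  Vanishing at the K-points would be too weak over a finite field. *)
Definition line_in_surface (L : {vspace 'rV[K]_4}) : Prop :=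
  forall v w, v \in L -> w \in L -> line_poly v w = 0.

(* The multiplicity at X of the intersection of L with the surface, for X on
   L and L not contained in the surface: if X = <v> and L = <v, w>, then t is a
   local parameter of L at X = (v + t w)_(t = 0).  The order of vanishing does
   not depend on v and w. *)
Definition line_mult (L X : {vspace 'rV[K]_4}) : nat :=
  if (X <= L)%VS then mup 0 (line_poly (vpick X) (vpick (L :\: X)%VS)) else 0%N.

Definition G_S := {freeg surface_pt / int}.

(* L . S = P + Q + R.  Only multiplicities at K-points are compared, but since
   L . S has degree 3 they leave no room for intersection points that are not
   K-rational. *)
Definition line_cycle (L : {vspace 'rV[K]_4}) (P Q R : surface_pt) : Prop :=
  forall X : surface_pt,
    coeff X (<<P>> + <<Q>> + <<R>> : G_S) = (line_mult L (val X))%:Z.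

Inductive collinear_cycle : G_S -> Prop :=
| collinear_proper (L : {vspace 'rV[K]_4}) (P Q R : surface_pt) :
    is_line L -> ~ line_in_surface L -> line_cycle L P Q R ->
    collinear_cycle (<<P>> + <<Q>> + <<R>>)
| collinear_contained (L : {vspace 'rV[K]_4}) (P Q R : surface_pt) :
    is_line L -> line_in_surface L ->
    (val P <= L)%VS -> (val Q <= L)%VS -> (val R <= L)%VS ->
    collinear_cycle (<<P>> + <<Q>> + <<R>>).

End Surface.

Inductive generated (V : zmodType) (A : V -> Prop) : V -> Prop :=
| generated_in x : A x -> generated A x
| generated_0 : generated A 0
| generated_sub x y : generated A x -> generated A y -> generated A (x - y).

Section Quotient.
Variables (K : fieldType) (F : {mpoly K[4]}).

Definition G'_S : pred (G_S F) :=
  fun D => `[< generated (@collinear_cycle K F) D >].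

Definition G''_S : pred (G_S F) := fun D => (D \in G'_S) && (deg D == 0).

Lemma G''_S_zmod_closed : zmod_closed G''_S.
Proof.
split=> [|D E]; rewrite !unfold_in.
  by rewrite raddf0 eqxx andbT; apply/asboolP/generated_0.
move=> /andP[/asboolP hD /eqP dD] /andP[/asboolP hE /eqP dE].
rewrite raddfB /= dD dE subrr eqxx andbT.
by apply/asboolP/generated_sub.
Qed.

HB.instance Definition _ :=
  GRing.isZmodClosed.Build (G_S F) G''_S G''_S_zmod_closed.

Definition H_S := Quotient.quot (GRing.ZmodClosed.clone _ G''_S _).

Definition degH (x : H_S) : int := deg (repr x).

Lemma degH_pi (D : G_S F) : degH (\pi_H_S D) = deg D.
Proof.
have : repr (\pi_H_S D) - D \in G''_S.
  by rewrite (Quotient.idealrBE (GRing.ZmodClosed.clone _ G''_S _)) reprK.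
by rewrite /degH unfold_in => /andP[_]; rewrite raddfB subr_eq0 => /eqP.
Qed.

Definition H0_S : pred H_S := fun x => degH x == 0.

End Quotient.

Arguments G'_S {K} F _.
Arguments G''_S {K} F _.
Arguments H0_S {K} F _.

Definition torsion (V : zmodType) (n : nat) : pred V := fun x => x *+ n == 0.

Arguments torsion V n _ : clear implicits.

(* Main.v *)
Require Import Defs.
From HB Require Import structures.
From mathcomp Require Import all_boot all_order all_algebra.
From mathcomp Require Import ring_quotient generic_quotient.
From mathcomp Require Import freeg mpoly.
From mathcomp Require Import boolp ring.

(** Torsion has degree zero because degrees live in the torsion-free group Z.
    The converse amounts to showing that 2 (P - Q0) belongs to the relations,
    for every rational point P of the surface and one fixed rational point Q0
    of the given line L: these elements generate twice the group of cycles of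
    degree zero.

    If P is not on L, the plane spanned by P and L meets the surface in L and a
    residual conic through P. A rational line through P tangent to that conic
    (any line of the plane through P, when the conic is singular at P) meets
    the surface twice at P and once at the point Q where it crosses L, unless
    it lies in the surface. In both cases P + P + Q is a collinear cycle, of
    the first or the second kind; if P is on L, then Q = P does. Since Q0 and Q
    lie on L, the cycle Q0 + Q0 + Q is collinear as well, and
    2 (P - Q0) = (P + P + Q) - (Q0 + Q0 + Q).

    The conic never has to be written down. Let p span P. For q in L the
    binary cubic form F (a p + b q) has no terms in a^3 and b^3, because P and
    L are in the surface, and its coefficient of a^2 b is a linear function of
    q, the differential of F at p ([line_poly_coef1]). A linear form on the
    two-dimensional space L has a nonzero zero q ([tangent_direction]), and
    then F (a p + b q) = c a b^2 ([tangent_line_poly]). The multiplicities of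
    intersection are read off this formula ([tangent_line_cycle]), which gives
    the collinear cycle P + P + Q ([tangent_collinear]). *)

Set Implicit Arguments.
Unset Strict Implicit.
Unset Printing Implicit Defensive.

Import GRing.Theory.

Local Open Scope ring_scope.
Local Open Scope quotient_scope.

(** * Restricting a form to a line *)

Lemma mpoly_ring_ind (n : nat) (R : comNzRingType) (P : {mpoly R[n]} -> Prop) :
    (forall c, P c%:MP) -> (forall i, P 'X_i) ->
    (forall p q, P p -> P q -> P (p + q)) ->
    (forall p q, P p -> P q -> P (p * q)) ->
  forall p, P p.
Proof.
move=> PC PX PD PM; elim/mpolyind => [|c m p _ _ Pp]; first by rewrite -mpolyC0.
apply: (PD) => //; rewrite -mul_mpolyC; apply: (PM) => //.
rewrite mpolyXE_id; apply: big_ind => [||i _]; [by rewrite -mpolyC1|exact: PM|].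
elim: (m i) => [|k IHk]; first by rewrite expr0 -mpolyC1.
by rewrite exprS; apply: PM.
Qed.

Section LinePoly.
Variable K : fieldType.
Implicit Types (F G : {mpoly K[4]}) (p q v w : 'rV[K]_4).

Lemma horner_line_poly G p q x :
  (line_poly G p q).[x] = G.@[fun i => p 0 i + x * q 0 i].
Proof.
rewrite /line_poly.
elim/(@mpoly_ring_ind 4 K): G => [c|i|G H IHG IHH|G H IHG IHH].
- by rewrite mmapC mevalC hornerC.
- by rewrite mmapX mmap1U mevalXU !hornerE mulrC.
- by rewrite mmapD mevalD hornerD IHG IHH.
- by rewrite !rmorphM /= hornerM IHG IHH.
Qed.

Lemma line_poly_coef0 G p q : (line_poly G p q)`_0 = G.@[p 0].
Proof.
rewrite -horner_coef0 horner_line_poly.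
by apply: meval_eq => i; rewrite mul0r addr0.
Qed.

(** The first-order term of a form along the line through [p] with direction
    [q] is the differential at [p] applied to [q]. What matters later is that
    it is linear in [q]. *)
Lemma line_poly_coef1 G p q :
  (line_poly G p q)`_1 = \sum_i (G^`M(i)).@[p 0] * q 0 i.
Proof.
elim/(@mpoly_ring_ind 4 K): G => [c|i|G H IHG IHH|G H IHG IHH].
- rewrite /line_poly mmapC coefC big1 // => i _.
  by rewrite mderivC meval0 mul0r.
- rewrite /line_poly mmapX mmap1U coefD coefC coefMX coefC add0r.
  rewrite (bigD1 i) //= big1 => [|j ji]; last first.
    by rewrite mderivX mnm1E eq_sym (negPf ji) scale0r meval0 mul0r.
  by rewrite mderivX mnm1E eqxx scale1r -[X in 'X_[X - _]]add0m addmK mpolyX0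
    meval1 mul1r addr0.
- rewrite /line_poly mmapD coefD [in LHS]IHG IHH -big_split /=.
  by apply: eq_bigr => i _; rewrite mderivD mevalD mulrDl.
- have -> : line_poly (G * H) p q = line_poly G p q * line_poly H p q.
    by rewrite /line_poly rmorphM.
  rewrite coefM big_ord_recl big_ord1 /=.
  rewrite !line_poly_coef0 IHG IHH mulr_sumr mulr_suml -big_split /=.
  by apply: eq_bigr => i _; rewrite mderivM mevalD !mevalM; ring.
Qed.

(** The arguments [a] and [b] range over polynomials, not over [K]: changing
    the basis of a line turns [F (v + t w)] into a value of the form at
    polynomials in [t], and over a finite field values at scalars would not
    determine the coefficients. *)
Definition is_binary_form d (g : {poly K} -> {poly K} -> {poly K}) :=
  exists c : nat -> K, forall a b,
    g a b = \sum_(i < d.+1) (c i)%:P * a ^+ (d - i) * b ^+ i.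

Lemma is_binary_form_lin d g x y : is_binary_form d g ->
  is_binary_form d.+1 (fun a b => (a * x%:P + b * y%:P) * g a b).
Proof.
move=> [c gE].
(* The coefficient of a^(d-i+1) b^i combines c i and c (i-1); the first test
   discards c (d+1), about which nothing is known. *)
exists (fun i => (if (i <= d)%N then x * c i else 0)
               + (if i is j.+1 then y * c j else 0)) => a b.
rewrite gE mulrDl !mulr_sumr.
under [RHS]eq_bigr => i _ do rewrite polyCD !mulrDl.
rewrite big_split /=; congr (_ + _).
  rewrite [RHS]big_ord_recr /= ltnn !mul0r addr0; apply: eq_bigr => i _.
  rewrite /= -ltnS ltn_ord polyCM subSn -1?ltnS // exprS; ring.
rewrite [RHS]big_ord_recl /= !mul0r add0r; apply: eq_bigr => i _.
by rewrite /bump /= add1n subSS polyCM exprS; ring.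
Qed.

(** Each monomial of degree [d] becomes a product of [d] linear forms, so the
    claim follows by multiplying in one linear form at a time. *)
Lemma homog_binary_form d G p q : G \is d.-homog ->
  is_binary_form d
    (fun a b => mmap polyC (fun i => a * (p 0 i)%:P + b * (q 0 i)%:P) G).
Proof.
move=> /dhomogP homG; rewrite /mmap.
elim: (msupp G) homG => [|m s IHs] homG.
  exists (fun=> 0) => a b; rewrite big_nil big1 // => i _.
  by rewrite !mul0r.
have [c sE] := IHs (fun m' m's => homG m' (@mem_behead _ (m :: s) m' m's)).
suff [c' mE] : is_binary_form d
    (fun a b => mmap1 (fun i => a * (p 0 i)%:P + b * (q 0 i)%:P) m).
  exists (fun i => G@_m * c' i + c i) => a b.
  rewrite big_cons sE mE mulr_sumr -big_split; apply: eq_bigr => i _ /=.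
  by rewrite polyCD polyCM; ring.
rewrite -(homG m (mem_head _ _)) /= mdegE /mmap1.
elim: (index_enum _) => [|i r [c' IHr]].
  rewrite big_nil; exists (fun=> 1) => a b.
  by rewrite big_nil big_ord_recl big_ord0 !expr0 !mulr1 addr0.
have IHi k : is_binary_form (k + \sum_(j <- r) m j) (fun a b =>
    (a * (p 0 i)%:P + b * (q 0 i)%:P) ^+ k *
    \prod_(j <- r) (a * (p 0 j)%:P + b * (q 0 j)%:P) ^+ m j).
  elim: k => [|k [c'' IHk]].
    by exists c' => a b; rewrite expr0 mul1r IHr.
  have [e eE] := is_binary_form_lin (p 0 i) (q 0 i) (ex_intro _ c'' IHk).
  by exists e => a b; rewrite addSn -eE exprS mulrA.
have [c'' mE] := IHi (m i).
by rewrite big_cons; exists c'' => a b; rewrite big_cons mE.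
Qed.

(** Three of the four coefficients of the cubic form on the line vanish: those
    of a^3 and b^3 since [p] and [q] are zeros of [F], that of a^2 b by
    tangency at [p]. The two points on the left are arbitrary, since the
    multiplicity at a point is computed in a basis chosen for that point. *)
Lemma tangent_line_poly F p q :
    F \is 3.-homog -> F.@[p 0] = 0 -> F.@[q 0] = 0 ->
    (line_poly F p q)`_1 = 0 ->
  exists c, forall a b a' b',
    line_poly F (a *: p + b *: q) (a' *: p + b' *: q)
      = c *: ((a%:P + a'%:P * 'X) * (b%:P + b'%:P * 'X) ^+ 2).
Proof.
move=> homF Fp Fq F1.
have [c cE] := homog_binary_form p q homF.
have lpE a b a' b' : line_poly F (a *: p + b *: q) (a' *: p + b' *: q)
    = \sum_(i < 4) (c i)%:P * (a%:P + a'%:P * 'X) ^+ (3 - i)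
                            * (b%:P + b'%:P * 'X) ^+ i.
  rewrite -cE /line_poly; congr (mmap _ _ F); apply/funext => i.
  by rewrite !mxE !polyCD !polyCM; ring.
(* Taking a = 1 and b = t shows that the c i are the coefficients of
   F (p + t q). *)
have lpq : line_poly F p q = \sum_(i < 4) (c i)%:P * 'X^i.
  have := lpE 1 0 0 1.
  rewrite !scale1r !scale0r addr0 add0r => ->; apply: eq_bigr => i _.
  by rewrite polyC1 polyC0 mul0r addr0 expr1n mulr1 add0r mul1r.
have c0 : c 0%N = 0.
  rewrite -Fp -(line_poly_coef0 F p q) lpq !big_ord_recl big_ord0 /=.
  by rewrite !coefD !coefCM !coefXn /= coef0; ring.
have c1 : c 1%N = 0.
  rewrite -F1 lpq !big_ord_recl big_ord0 /=.
  by rewrite !coefD !coefCM !coefXn /= coef0; ring.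
have c3 : c 3%N = 0.
  rewrite -Fq -(line_poly_coef0 F q 0).
  have := lpE 0 1 0 0; rewrite !scale0r scale1r !add0r => ->.
  rewrite !big_ord_recl big_ord0 /= polyC0 polyC1 !mul0r !addr0 expr1n.
  by rewrite !expr0n !expr1n /bump /= ?mulr0n ?mulr1n
    ?(mulr0, mul0r, add0r, mulr1) coefC.
exists (c 2%N) => a b a' b'; rewrite lpE !big_ord_recl big_ord0 /=.
by rewrite c0 c1 c3 -mul_polyC; ring.
Qed.

Lemma mup0_lin (a a' : K) : (a != 0) || (a' != 0) ->
  (a%:P + a'%:P * 'X != 0) /\ mup 0 (a%:P + a'%:P * 'X) = (a == 0).
Proof.
have [-> /= a'0|a0 _] := eqVneq a 0; last first.
  have rootN : ~~ root (a%:P + a'%:P * 'X) 0.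
    by rewrite rootE !hornerE.
  split; last by rewrite mupNroot.
  by apply: contraNneq rootN => ->; rewrite root0.
rewrite polyC0 add0r mul_polyC scaler_eq0 (negPf a'0) polyX_eq0; split=> //.
rewrite -mul_polyC mupMr ?rootC //.
by have := mup_XsubCX 1 0 (0 : K); rewrite expr1 subr0 eqxx.
Qed.

(** The condition on the determinant says that the points (a : b) and (a' : b')
    differ. The multiplicity is 1 at the zero of the simple factor and 2 at
    that of the squared one. *)
Lemma mup0_tangent (c a b a' b' : K) : c != 0 -> a * b' != a' * b ->
  mup 0 (c *: ((a%:P + a'%:P * 'X) * (b%:P + b'%:P * 'X) ^+ 2))
    = ((a == 0%R) + (b == 0%R) * 2)%N.
Proof.
move=> c0 ab.
have [A0 muA] : (a%:P + a'%:P * 'X != 0) /\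
    mup 0 (a%:P + a'%:P * 'X) = (a == 0).
  apply: mup0_lin; apply: contraNT ab; rewrite negb_or !negbK.
  by move=> /andP[/eqP-> /eqP->]; rewrite !mul0r.
have [B0 muB] : (b%:P + b'%:P * 'X != 0) /\
    mup 0 (b%:P + b'%:P * 'X) = (b == 0).
  apply: mup0_lin; apply: contraNT ab; rewrite negb_or !negbK.
  by move=> /andP[/eqP-> /eqP->]; rewrite !mulr0.
rewrite -mul_polyC mupMr ?rootC // expr2 !mupM ?mulf_neq0 // muA muB.
by rewrite muln2 addnn.
Qed.

(** The directions tangent at [p] form the kernel of the differential, which
    meets every subspace of dimension at least two. *)
Lemma tangent_direction F p (L : {vspace 'rV[K]_4}) : (1 < \dim L)%N ->
  exists2 q, q \in L & (q != 0) && ((line_poly F p q)`_1 == 0).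
Proof.
move=> dimL.
pose f := linfun (mulmxr (\col_i (F^`M(i)).@[p 0])) : 'Hom('rV[K]_4, 'rV[K]_1).
pose q := vpick (L :&: lker f)%VS; exists q.
  by have := memv_pick (L :&: lker f)%VS; rewrite memv_cap => /andP[].
apply/andP; split.
  rewrite vpick0 -dimv_eq0 -lt0n -(ltn_add2r (\dim (f @: L))) limg_ker_dim.
  rewrite add0n (leq_ltn_trans _ dimL) // (leq_trans (dimvS (subvf _))) //.
  by rewrite dimvf.
have := memv_pick (L :&: lker f)%VS.
rewrite memv_cap memv_ker lfunE /= => /andP[_ /eqP/rowP/(_ 0)].
rewrite !mxE line_poly_coef1 => fq0; apply/eqP; rewrite -[RHS]fq0.
by apply: eq_bigr => i _; rewrite mxE mulrC.
Qed.

End LinePoly.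

(** * The collinear cycle given by a tangent *)

Section Tangent.
Variables (K : fieldType) (F : {mpoly K[4]}).
Implicit Types (L U X : {vspace 'rV[K]_4}).

Lemma line_pick U : \dim U = 1%N -> U = <[vpick U]>%VS.
Proof.
move=> dimU; apply/esym/eqP; rewrite eqEdim -memvE memv_pick dim_vline dimU.
by rewrite vpick0 -dimv_eq0 dimU.
Qed.

Lemma line_in_surface_meval L v :
  line_in_surface F L -> v \in L -> F.@[v 0] = 0.
Proof. by move=> LS vL; rewrite -(line_poly_coef0 F v 0) LS ?mem0v ?coef0. Qed.

Lemma vline_on_surface L v :
  line_in_surface F L -> v \in L -> v != 0 -> on_surface F <[v]>%VS.
Proof.
move=> LS vL v0; rewrite /on_surface dim_vline v0 eqxx /=; apply/eqP.
apply: (line_in_surface_meval LS); apply: (subvP _ _ (memv_pick _)).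
by rewrite -memvE.
Qed.

(** In the coordinates (a : b) of the line spanned by [p] and [q], the point
    [P] is b = 0 and [Q] is a = 0; the formula for [F] vanishes to order two at
    the former, to order one at the latter, and nowhere else since [c] is not
    zero. *)
Lemma tangent_line_cycle p q (P Q : surface_pt F) c :
    val P = <[p]>%VS -> val Q = <[q]>%VS -> free [:: p; q] -> c != 0 ->
    (forall a b a' b',
      line_poly F (a *: p + b *: q) (a' *: p + b' *: q)
        = c *: ((a%:P + a'%:P * 'X) * (b%:P + b'%:P * 'X) ^+ 2)) ->
  line_cycle <<[:: p; q]>>%VS P P Q.
Proof.
move=> Pp Qq pqF c0 lpE X; set M := <<_>>%VS.
have memM v : v \in M -> exists a b, v = a *: p + b *: q.
  rewrite /M span_cons span_seq1 => /memv_addP[_ /vlineP[a ->]].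
  by move=> [_ /vlineP[b ->] ->]; exists a, b.
have pNq : p \notin <[q]>%VS.
  by move: pqF; rewrite free_cons span_seq1 => /andP[].
have qNp : q \notin <[p]>%VS.
  apply: contra pNq => /vlineP[k qE]; rewrite qE; apply/vlineP; exists k^-1.
  rewrite scalerA mulVf ?scale1r //; apply: contraTneq pqF => k0.
  by rewrite qE k0 scale0r free_cons seq1_free eqxx andbF.
have dimX : \dim (val X) = 1%N by have /andP[/eqP] := valP X.
set v := vpick (val X).
have Xv : val X = <[v]>%VS by exact: line_pick.
have v0 : v != 0 by rewrite vpick0 -dimv_eq0 dimX.
have eqX (r : 'rV[K]_4) (R : surface_pt F) :
    val R = <[r]>%VS -> (R == X) = (v \in <[r]>%VS).
  move=> Rr; have /andP[/eqP dimR _] := valP R.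
  by rewrite eq_sym -val_eqE /= eqEdim dimX dimR leqnn andbT Rr Xv -memvE.
rewrite !coeffD !coeffU !mul1r (eqX p P) // (eqX q Q) // /line_mult -/v.
have [XM|XNM] := ifPn; last first.
  have NM r : r \in M -> (v \in <[r]>%VS) = false.
    move=> rM; apply: contraNF XNM => vr; rewrite Xv -memvE.
    by apply: (subvP _ _ vr); rewrite -memvE.
  by rewrite !NM // memv_span // !inE eqxx ?orbT.
have vM : v \in M by apply: (subvP XM); exact: memv_pick.
set w := vpick (M :\: val X)%VS.
have wM : w \in M by apply: (subvP (diffvSl M (val X))); exact: memv_pick.
(* The second vector of the local parametrization at X is off X, so the change
   of basis below is invertible. *)
have wNX : w \notin val X.
  apply/negP => wX.
  have : w \in ((M :\: val X) :&: val X)%VS by rewrite memv_cap memv_pick.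
  rewrite capv_diff memv0 vpick0 diffv_eq0 => /dimvS.
  by rewrite dimX (eqP pqF).
have [a [b vE]] := memM v vM; have [a' [b' wE]] := memM w wM.
rewrite wE vE lpE mup0_tangent //; last first.
  apply: contraNneq wNX => det; rewrite Xv.
  (* If a b' = a' b, then a w = a' v and b w = b' v; as a and b are not both
     zero, w is a multiple of v. *)
  have aw : a *: w \in <[v]>%VS.
    by apply/vlineP; exists a'; rewrite wE vE !scalerDr !scalerA det mulrC.
  have bw : b *: w \in <[v]>%VS.
    apply/vlineP; exists b'; rewrite wE vE !scalerDr !scalerA.
    by rewrite [b' * a]mulrC det [a' * b]mulrC [b' * b]mulrC.
  move: aw bw; rewrite !rpredZeq => /orP[/eqP a0|//] /orP[/eqP b0|//].
  by move: v0; rewrite vE a0 b0 !scale0r addr0 eqxx.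
rewrite (rpredDl _ (memvZ _ (memv_line p))) rpredZeq (negPf qNp) orbF.
rewrite (rpredDr _ (memvZ _ (memv_line q))) rpredZeq (negPf pNq) orbF.
by case: (a == 0) (b == 0) => [] [].
Qed.

(** When the tangent line lies in the surface, or when [P] is on [L], the cycle
    is collinear by the rule on lines contained in the surface. *)
Lemma tangent_collinear L (P : surface_pt F) :
    F \is 3.-homog -> is_line L -> line_in_surface F L ->
  exists2 Q : surface_pt F, (val Q <= L)%VS &
    collinear_cycle (<<P>> + <<P>> + <<Q>> : G_S F).
Proof.
move=> homF dimL LS.
have [PL|PNL] := boolP (val P <= L)%VS.
  by exists P => //; apply: (collinear_contained (L := L)).
have /andP[/eqP dimP /eqP] := valP P; set p := vpick (val P) => Fp.
have Pp : val P = <[p]>%VS by exact: line_pick.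
have [|q qL /andP[q0 /eqP F1]] := @tangent_direction _ F p L.
  by rewrite (eqP dimL).
have QL : (<[q]> <= L)%VS by rewrite -memvE.
have Fq : F.@[q 0] = 0 by exact: line_in_surface_meval qL.
pose Q : surface_pt F := exist _ <[q]>%VS (vline_on_surface LS qL q0).
exists Q => //.
have pqF : free [:: p; q].
  rewrite free_cons span_seq1 seq1_free q0 andbT; apply: contra PNL => pq.
  by rewrite Pp -memvE (subvP QL).
have PM : (val P <= <<[:: p; q]>>)%VS.
  by rewrite Pp -memvE memv_span ?mem_head.
have QM : (val Q <= <<[:: p; q]>>)%VS.
  by rewrite -memvE memv_span // !inE eqxx orbT.
have [MS|MNS] := pselect (line_in_surface F <<[:: p; q]>>).
  exact: (collinear_contained (L := <<[:: p; q]>>%VS)).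
have [c cE] := tangent_line_poly homF Fp Fq F1.
apply: (collinear_proper (L := <<[:: p; q]>>%VS)) => //.
apply: (@tangent_line_cycle p q P Q c) => //.
apply/eqP => c0; apply: MNS => v w.
rewrite span_cons span_seq1 => /memv_addP[_ /vlineP[a ->]].
move=> [_ /vlineP[b ->] ->] /memv_addP[_ /vlineP[a' ->]].
by move=> [_ /vlineP[b' ->] ->]; rewrite cE c0 scale0r.
Qed.

Lemma point_on_line L : is_line L -> line_in_surface F L ->
  exists Q : surface_pt F, (val Q <= L)%VS.
Proof.
move=> dimL LS.
have v0 : vpick L != 0 by rewrite vpick0 -dimv_eq0 (eqP dimL).
have QS := vline_on_surface LS (memv_pick L) v0.
by exists (exist _ <[vpick L]>%VS QS); rewrite /= -memvE memv_pick.
Qed.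

(** * Twice a cycle of degree zero *)

Lemma double_mem_G''_S L : F \is 3.-homog -> is_line L -> line_in_surface F L ->
  forall D : G_S F, deg D = 0 -> D *+ 2 \in G''_S F.
Proof.
move=> homF dimL LS D degD.
have [Q0 Q0L] := point_on_line dimL LS.
(* Subtracting deg D copies of Q0 gives a statement about all cycles, which
   is additive and can be proved by induction on the support. *)
suff redD : (D - << deg D *g Q0 >>) *+ 2 \in G''_S F.
  by move: redD; rewrite degD freegU0 subr0.
rewrite {degD}.
have ptQ0 P : (<<P>> - <<Q0>> : G_S F) *+ 2 \in G''_S F.
  have [Q QL PPQ] := tangent_collinear P homF dimL LS.
  have -> : (<<P>> - <<Q0>> : G_S F) *+ 2
          = (<<P>> + <<P>> + <<Q>>) - (<<Q0>> + <<Q0>> + <<Q>>).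
    by rewrite mulr2n !opprD [RHS]addrACA subrr addr0 addrACA.
  rewrite unfold_in; apply/andP; split; last first.
    by rewrite degB !degD !degU subrr.
  apply/asboolP/generated_sub; apply: generated_in => //.
  exact: (collinear_contained (L := L)).
elim/freeg_ind_dom0: D => [|k P D _ _ IHD].
  by rewrite deg0 freegU0 subr0 mul0rn rpred0.
rewrite degD degU -freegUD opprD addrACA mulrnDl rpredD //.
have kE R : << k *g R >> = << R >> *~ k :> G_S F by rewrite freegU_mulz intz.
by rewrite !kE -mulrzBl pmulrn mulrzAC -pmulrn rpredMz.
Qed.

End Tangent.

Theorem theorem6 (K : fieldType) (F : {mpoly K[4]})
    (F_cubic : F \is 3.-homog) (F_smooth : smooth_surface F)
    (L : {vspace 'rV[K]_4}) (L_line : is_line L)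
    (L_in_S : line_in_surface F L) :
  H0_S F =i torsion (H_S F) 2.
Proof.
move=> x; rewrite -[x]reprK; set D := repr x.
rewrite !unfold_in degH_pi.
have -> : (\pi_(H_S F) D *+ 2 == 0) = (D *+ 2 \in G''_S F).
  have := Quotient.idealrBE (GRing.ZmodClosed.clone _ (G''_S F) _) (D *+ 2) 0.
  rewrite subr0 => ->.
  by rewrite -(raddfMn \pi_(H_S F)); congr (_ == _); rewrite raddf0.
apply/eqP/idP => [degD|]; first exact: (double_mem_G''_S F_cubic L_line).
rewrite unfold_in => /andP[_]; rewrite degMn Num.Theory.mulrn_eq0 /=.
by move/eqP.
Qed.
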